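(* Let $A$ be an $n\times n$ nonsingular, block strongly nonsingular matrix with a blocking of $n_t$ blocks and largest block size $n_b$, and let $A=LR$ be a block LU factorization (computed by the block LU algorithm in exact arithmetic) in which every diagonal block $L_{kk}$ is unitary. Let $\|\cdot\|_p$ be a Schatten $p$-norm, $1\le p\le\infty$ (with $n_b^{1/p}=1$ for $p=\infty$, the spectral norm). Then $$\|L\|_p\le n_b^{1/p}n_t+n_t\rho_p\kappa_p(A),\qquad \|R\|_p\le n_t\rho_p\|A\|_p,$$ and hence $\|L\|_p\|R\|_p\le n_t^2\rho_p^2\kappa_p(A)\|A\|_p+n_b^{1/p}n_t^2\rho_p\|A\|_p$. The analogous result holds if instead the diagonal blocks of $R$ are unitary.
   Context: Blocking: a strictly increasing list $[1=\mathcal{I}_1<\dots<\mathcal{I}_{n_t+1}=n+1]$ defining blocks $A_{i,j}$ (rows $\mathcal{I}_i:\mathcal{I}_{i+1}-1$, columns $\mathcal{I}_j:\mathcal{I}_{j+1}-1$). Block strongly nonsingular: each leading block principal submatrix $A_{1:k,1:k}$ is nonsingular. Block LU algorithm: $A^{(1)}=A$; for $k=1,\dots,n_t$, factor $A^{(k)}_{kk}=L_{kk}R_{kk}$ (any factorization into nonsingular factors), set $L_{k+1:n_t,k}=A^{(k)}_{k+1:n_t,k}R_{kk}^{-1}$, $R_{k,k+1:n_t}=L_{kk}^{-1}A^{(k)}_{k,k+1:n_t}$, and $A^{(k+1)}=A^{(k)}_{k+1:n_t,k+1:n_t}-L_{k+1:n_t,k}R_{k,k+1:n_t}$; $L$ is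 block lower triangular and $R$ block upper triangular. Block growth factor $\rho_p=\max_{1\le k\le n_t}\|A^{(k)}\|_p/\|A\|_p$. $\kappa_p(A)=\|A\|_p\|A^{-1}\|_p$. *)

(* Defs.v *)
From HB Require Import structures.
From mathcomp Require Import all_boot all_order all_algebra.
From mathcomp Require Import all_classical all_reals.
From mathcomp Require Import exp.
From mathcomp.real_closed Require Import complex.

Set Implicit Arguments.
Unset Strict Implicit.
Unset Printing Implicit Defensive.

Import Order.TTheory GRing.Theory Num.Theory.
Local Open Scope ring_scope.

(* Conventions.
   - Scalars: complex numbers C := R[i] over a real field R : realType.
   - Indices are 0-based: a blocking is a sequence b = [b_0 < b_1 < ... < b_nt]
     with b_0 = 0 and b_nt = n; block k (k < nt) consists of the rows/columns
     b_k, ..., b_(k+1) - 1.  (The paper's I_k is b_(k-1) + 1.) *)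

Section Defs.
Variable R : realType.
Local Notation C := (R[i]).

Definition ctr m1 m2 (M : 'M[C]_(m1, m2)) : 'M[C]_(m2, m1) :=
  (map_mx Num.conj M)^T.

Definition unitary m (U : 'M[C]_m) : Prop := ctr U *m U = 1%:M.

(* eigenvalues (with multiplicity) of the Gram matrix M^* M, i.e. the roots of
   its characteristic polynomial in the algebraically closed field C *)
Definition gram_eigs m (M : 'M[C]_m) : seq C :=
  sval (closed_field_poly_normal (char_poly (ctr M *m M))).

(* singular values of M: square roots of the eigenvalues of M^* M
   (these eigenvalues are real and nonnegative) *)
Definition sing_vals m (M : 'M[C]_m) : seq R :=
  [seq Num.sqrt (complex.Re z) | z <- gram_eigs M].

Definition schatten (p : \bar R) m (M : 'M[C]_m) : R :=
  match p with
  | EFin r => (\sum_(s <- sing_vals M) s `^ r) `^ r^-1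
  | _ => \big[Num.max/0]_(s <- sing_vals M) s
  end.

Definition pow_inv_p (p : \bar R) (x : R) : R :=
  match p with
  | EFin r => x `^ r^-1
  | _ => 1
  end.

Definition kappa (p : \bar R) m (A : 'M[C]_m) : R :=
  schatten p A * schatten p (invmx A).

Definition ent m (M : 'M[C]_m) (i j : nat) : C :=
  match insub i, insub j with
  | Some i', Some j' => M i' j'
  | _, _ => 0
  end.

Definition subm m (M : 'M[C]_m) (r0 c0 m1 m2 : nat) : 'M[C]_(m1, m2) :=
  \matrix_(i < m1, j < m2) ent M (r0 + i) (c0 + j).

Definition blocking (n nt : nat) (b : seq nat) : Prop :=
  [/\ size b = nt.+1, sorted ltn b, nth 0%N b 0 = 0%N & nth 0%N b nt = n].

Definition max_block (nt : nat) (b : seq nat) : nat :=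
  \max_(k < nt) (nth 0%N b k.+1 - nth 0%N b k)%N.

Definition block_strongly_nonsingular n (nt : nat) (b : seq nat)
  (A : 'M[C]_n) : Prop :=
  forall k, (0 < k <= nt)%N ->
    subm A 0 0 (nth 0%N b k) (nth 0%N b k) \in unitmx.

Definition block_lower n nt (b : seq nat) (L : 'M[C]_n) : Prop :=
  forall k (i j : 'I_n), (k <= nt)%N -> (i < nth 0%N b k <= j)%N -> L i j = 0.

Definition block_upper n nt (b : seq nat) (U : 'M[C]_n) : Prop :=
  forall k (i j : 'I_n), (k <= nt)%N -> (j < nth 0%N b k <= i)%N -> U i j = 0.

(* The k-th active matrix A^(k) of the block LU algorithm (0-based k),
   of size (n - b_k): unrolling the recurrence
   A^(k+1) = A^(k)_{k+1:,k+1:} - L_{k+1:,k} R_{k,k+1:}, A^(0) = A,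
   one has A^(k) = A_{k:,k:} - sum_{l<k} L_{k:,l} R_{l,k:}. *)
Definition active n (b : seq nat) (A L U : 'M[C]_n) (k : nat)
  : 'M[C]_(n - nth 0%N b k) :=
  let bk := nth 0%N b k in
  \matrix_(i < n - bk, j < n - bk)
    (ent A (bk + i) (bk + j)
     - \sum_(t < bk) ent L (bk + i) t * ent U t (bk + j)).

Definition block_LU n nt (b : seq nat) (A L U : 'M[C]_n) : Prop :=
  [/\ block_lower nt b L, block_upper nt b U &
  forall k, (k < nt)%N ->
    let bk := nth 0%N b k in
    let bk1 := nth 0%N b k.+1 in
    let s := (bk1 - bk)%N in
    let Ak := active b A L U k in
    let Lkk := subm L bk bk s s in
    let Ukk := subm U bk bk s s in
    [/\ Lkk \in unitmx, Ukk \in unitmx,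
        Lkk *m Ukk = subm Ak 0 0 s s,
        subm L bk1 bk (n - bk1) s = subm Ak s 0 (n - bk1) s *m invmx Ukk &
        subm U bk bk1 s (n - bk1) = invmx Lkk *m subm Ak 0 s s (n - bk1)]].

Definition growth (p : \bar R) n nt (b : seq nat) (A L U : 'M[C]_n) : R :=
  \big[Num.max/0]_(k < nt) (schatten p (active b A L U k) / schatten p A).

End Defs.

(* Main.v *)
(* Schatten norms are handled through one variational fact: for contractions [P]
   and [Q], the p-norm of the diagonal of [P M Q] is at most the Schatten p-norm of
   [M], and equality is attained at a singular value decomposition.  Triangle
   inequality, invariance under adjoint, monotonicity under compression and
   submultiplicativity all follow.

   For the factorization [A = L U], let [P_k] project onto the coordinates from
   block [k] on and [E_k = P_k - P_(k+1)].  The zero-padded active matrix is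
   [L P_k U].  If [D_k = E_k L E_k] is a partial isometry, then
     [E_k U = D_k^* (L P_k U)]  and  [P_(k+1) L E_k = - (L P_(k+1) U) A^-1 D_k],
   the second identity being the relation between the inverse of a block matrix
   and its Schur complement.  Each block row of [U] is thus bounded by
   [rho |A|] and each strictly lower block column of [L] by [rho kappa(A)]; summing
   over the blocks gives the bounds.  The case of unitary diagonal blocks of [U]
   is the first one applied to [A^* = U^* L^*]. *)
Require Import Defs.
From HB Require Import structures.
From mathcomp Require Import all_boot all_order all_algebra.
From mathcomp Require Import all_classical all_reals.
From mathcomp Require Import exp.
From mathcomp.real_closed Require Import complex.
From mathcomp Require Import ring lra.
Import Order.TTheory GRing.Theory Num.Theory.
Local Open Scope ring_scope.
Set Implicit Arguments.
Unset Strict Implicit.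

(** * Finite p-norms *)

Section VectorNorm.
Variable R : realType.
Implicit Types (p : \bar R) (r : R).

(** Young's inequality for [x * 1] with exponent [r] and its conjugate, multiplied by [r]. *)
Lemma powR_bernoulli r (x : R) : 1 <= r -> 0 <= x -> 1 + r * (x - 1) <= x `^ r.
Proof.
rewrite le_eqVlt => /predU1P[<- x0|r1 x0]; first by rewrite powRr1// mul1r addrC subrK.
have r0 : 0 < r by apply: lt_trans r1.
have q0 : 0 < (1 - r^-1)^-1 by rewrite invr_gt0 subr_gt0 invf_lt1.
have := conjugate_powR x0 ler01 r0 q0.
rewrite invrK addrC subrK powR1 mulr1 mul1r => /(_ erefl) xr.
have : x * r <= (x `^ r / r + (1 - r^-1)) * r by rewrite ler_pM2r.
have -> : (x `^ r / r + (1 - r^-1)) * r = x `^ r + r - 1.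
  by field; rewrite gt_eqF.
lra.
Qed.

Lemma le_powR r (x y : R) : 0 <= r -> 0 <= x -> x <= y -> x `^ r <= y `^ r.
Proof.
by move=> r0 x0 xy; apply: ge0_ler_powR => //; rewrite nnegrE// (le_trans x0).
Qed.

Lemma powRVK r (x : R) : 0 < r -> 0 <= x -> (x `^ r^-1) `^ r = x.
Proof. by move=> r0 x0; rewrite -powRrM mulVf ?gt_eqF// powRr1. Qed.

Lemma sumr_powR_ge0 r n (s : 'I_n -> R) : 0 <= \sum_i s i `^ r.
Proof. by apply: sumr_ge0 => i _; exact: powR_ge0. Qed.

(** Bernoulli at [s i / a] gives the tangent line of the power function at [a]. Weights of total [x]
    below [1] are allowed because [(1 - r) * (x - 1) >= 0]. *)
Lemma powR_jensen r n (c s : 'I_n -> R) : 1 <= r ->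
  (forall i, 0 <= c i) -> (forall i, 0 <= s i) -> \sum_i c i <= 1 ->
  (\sum_i c i * s i) `^ r <= \sum_i c i * s i `^ r.
Proof.
move=> r1 c0 s0 c1; set a := \sum_i c i * s i.
have r0 : 0 < r by apply: lt_le_trans r1.
have a0 : 0 <= a by apply: sumr_ge0 => i _; apply: mulr_ge0.
have [->|an0] := eqVneq a 0.
  rewrite powR0 ?gt_eqF//; apply: sumr_ge0 => i _.
  by rewrite mulr_ge0// powR_ge0.
have agt0 : 0 < a by rewrite lt_def an0.
have tangent i : a `^ r * (1 + r * (s i / a - 1)) <= s i `^ r.
  have -> : s i `^ r = a `^ r * (s i / a) `^ r.
    by rewrite -powRM// ?divr_ge0// mulrC divfK.
  by rewrite ler_wpM2l ?powR_ge0// powR_bernoulli// divr_ge0.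
apply: (@le_trans _ _ (\sum_i c i * (a `^ r * (1 + r * (s i / a - 1))))); last first.
  by apply: ler_sum => i _; rewrite ler_wpM2l.
have -> : \sum_i c i * (a `^ r * (1 + r * (s i / a - 1))) =
    a `^ r * ((1 - r) * \sum_i c i + r / a * \sum_i c i * s i).
  rewrite mulrDr !mulr_sumr -big_split /=; apply: eq_bigr => i _.
  by field.
rewrite -/a divfK// -[leLHS]mulr1 ler_wpM2l ?powR_ge0//.
set x := \sum_i c i in c1 *; nra.
Qed.

Definition pnorm p n (s : 'I_n -> R) : R :=
  match p with
  | EFin r => (\sum_i s i `^ r) `^ r^-1
  | _ => \big[Num.max/0]_i s i
  end.

Lemma pnorm_ge0 p n (s : 'I_n -> R) : 0 <= pnorm p s.
Proof. by case: p => [r||] /=; rewrite ?powR_ge0// bigmax_ge_id. Qed.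

(** Jensen along each row, then an exchange of sums and the column bounds. For [p = +oo] the row
    bounds control the maximum. *)
Lemma pnorm_substochastic p m n (t : 'I_m -> R) (s : 'I_n -> R)
    (c : 'I_m -> 'I_n -> R) : (1 <= p)%E ->
  (forall i, 0 <= t i) -> (forall j, 0 <= s j) -> (forall i j, 0 <= c i j) ->
  (forall i, \sum_j c i j <= 1) -> (forall j, \sum_i c i j <= 1) ->
  (forall i, t i <= \sum_j c i j * s j) -> pnorm p t <= pnorm p s.
Proof.
move=> p1 t0 s0 c0 rows cols le_t.
case: p p1 => [r||]//= p1; last first.
  apply: bigmax_le => [|i _]; first exact: bigmax_ge_id.
  set M := (X in _ <= X); have M0 : 0 <= M by exact: bigmax_ge_id.
  apply: le_trans (le_t i) _; apply: (@le_trans _ _ (\sum_j c i j * M)).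
    by apply: ler_sum => j _; rewrite ler_wpM2l// le_bigmax.
  by rewrite -mulr_suml ler_piMl.
rewrite lee_fin in p1.
have r0 : 0 <= r by apply: le_trans p1.
apply: le_powR; rewrite ?invr_ge0 ?sumr_powR_ge0//.
apply: (@le_trans _ _ (\sum_i \sum_j c i j * s j `^ r)).
  apply: ler_sum => i _; apply: le_trans (powR_jensen p1 (c0 i) s0 (rows i)).
  exact: le_powR.
rewrite exchange_big /=; apply: ler_sum => j _.
by rewrite -mulr_suml ler_piMl ?powR_ge0.
Qed.

Lemma pnorm_le p n (s t : 'I_n -> R) : (1 <= p)%E ->
  (forall i, 0 <= s i) -> (forall i, s i <= t i) -> pnorm p s <= pnorm p t.
Proof.
move=> p1 s0 st.
have t0 i : 0 <= t i by apply: le_trans (s0 i) (st i).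
have sum1 i : \sum_j ((i == j)%:R : R) = 1.
  by rewrite (bigD1 i)//= eqxx big1 ?addr0// => j /negPf ji; rewrite eq_sym ji.
apply: (@pnorm_substochastic p _ _ s t (fun i j => (i == j)%:R)) => //.
- by move=> i; rewrite sum1.
- by move=> j; under eq_bigr do rewrite eq_sym; rewrite sum1.
- move=> i; rewrite (bigD1 i)//= eqxx mul1r big1 ?addr0// => j /negPf ji.
  by rewrite eq_sym ji mul0r.
Qed.

Lemma pnormZ p n (s : 'I_n -> R) (a : R) : (1 <= p)%E -> 0 <= a ->
  (forall i, 0 <= s i) -> pnorm p (fun i => a * s i) = a * pnorm p s.
Proof.
case: p => [r||]//= p1 a0 s0; last first.
  elim/big_rec2: _ => [|i x y _ ->]; first by rewrite mulr0.
  by rewrite maxr_pMr.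
rewrite lee_fin in p1; have r0 : 0 < r by apply: lt_le_trans p1.
under eq_bigr do rewrite powRM//.
rewrite -mulr_sumr powRM ?powR_ge0 ?sumr_powR_ge0//.
by rewrite -powRrM mulfV ?gt_eqF// powRr1.
Qed.

Lemma le_pnorm p n (s : 'I_n -> R) i : (1 <= p)%E -> (forall i, 0 <= s i) ->
  s i <= pnorm p s.
Proof.
case: p => [r||]//= p1 s0; last exact: le_bigmax.
rewrite lee_fin in p1; have r0 : 0 < r by apply: lt_le_trans p1.
have -> : s i = (s i `^ r) `^ r^-1 by rewrite -powRrM mulfV ?gt_eqF// powRr1.
apply: le_powR; rewrite ?powR_ge0// ?invr_ge0 ?(ltW r0)//.
by rewrite (bigD1 i)//= lerDl sumr_ge0// => j _; exact: powR_ge0.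
Qed.

(** Minkowski's inequality. For finite [p], with [a] and [b] the norms of [s] and [t], the vector
    [(s + t) / (a + b)] is a convex combination of [s / a] and [t / b], to which Jensen applies
    coordinatewise. *)
Lemma pnormD p n (s t : 'I_n -> R) : (1 <= p)%E ->
  (forall i, 0 <= s i) -> (forall i, 0 <= t i) ->
  pnorm p (fun i => s i + t i) <= pnorm p s + pnorm p t.
Proof.
case: p => [r||]//= p1 s0 t0; last first.
  by apply: bigmax_le => [|i _]; rewrite ?addr_ge0 ?bigmax_ge_id// lerD// le_bigmax.
have r1 : 1 <= r by rewrite -lee_fin.
have r0 : 0 < r by apply: lt_le_trans r1.
have abstract_norm (u : 'I_n -> R) : (forall i, 0 <= u i) ->
    exists2 a, (\sum_i u i `^ r) `^ r^-1 = a &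
      [/\ 0 <= a, a `^ r = \sum_i u i `^ r & forall i, u i <= a].
  move=> u0; eexists; first reflexivity; split.
  - exact: powR_ge0.
  - by apply: powRVK => //; exact: sumr_powR_ge0.
  - by move=> i; exact: (le_pnorm i p1 u0).
have [a -> [a0 aE les]] := abstract_norm s s0.
have [b -> [b0 bE let_]] := abstract_norm t t0.
have [ab0|abn0] := eqVneq (a + b) 0.
  rewrite ab0 big1 ?powR0 ?invr_eq0 ?gt_eqF// => i _.
  suff -> : s i + t i = 0 by rewrite powR0 ?gt_eqF.
  have := les i; have := let_ i; have := s0 i; have := t0 i; lra.
have ab : 0 < a + b by rewrite lt_def abn0 addr_ge0.
have -> : a + b = ((a + b) `^ r) `^ r^-1.
  by rewrite -powRrM mulfV ?gt_eqF// powRr1// ltW.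
apply: le_powR; rewrite ?sumr_powR_ge0// ?invr_ge0 ?(ltW r0)//.
(* The factor [d] on both sides lets the bound cover [d = 0] as well. *)
have normalized (u : 'I_n -> R) d : 0 <= d -> d `^ r = \sum_i u i `^ r ->
    (forall i, 0 <= u i) -> d * (\sum_i (u i / d) `^ r) <= d.
  move=> d0 dE u0; have [->|dn0] := eqVneq d 0; first by rewrite mul0r.
  rewrite ler_piMr//.
  have -> : \sum_i (u i / d) `^ r = (\sum_i u i `^ r) * (d^-1 `^ r).
    by rewrite mulr_suml; apply: eq_bigr => i _; rewrite powRM// invr_ge0.
  by rewrite -dE -powRM ?invr_ge0// mulfV// powR1.
apply: (@le_trans _ _ ((a + b) `^ r * \sum_i
    (a / (a + b) * (s i / a) `^ r + b / (a + b) * (t i / b) `^ r))).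
  rewrite mulr_sumr; apply: ler_sum => i _.
  have -> : s i + t i = (a + b) * (a / (a + b) * (s i / a) + b / (a + b) * (t i / b)).
    (* The inverse of [0] is [0], and a vanishing norm [a] forces [s i = 0], so the identity
       survives [a = 0]. *)
    have sE : a * (s i / a) = s i.
      have [a00|an0] := eqVneq a 0; last by rewrite mulrC divfK.
      by rewrite a00 mul0r; apply/eqP; rewrite eq_le s0 -[X in _ <= X]a00 les.
    have tE : b * (t i / b) = t i.
      have [b00|bn0] := eqVneq b 0; last by rewrite mulrC divfK.
      by rewrite b00 mul0r; apply/eqP; rewrite eq_le t0 -[X in _ <= X]b00 let_.
    rewrite -[in LHS]sE -[in LHS]tE; move: (s i / a) (t i / b) => x y.
    by field.
  have sa0 : 0 <= s i / a by rewrite divr_ge0.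
  have tb0 : 0 <= t i / b by rewrite divr_ge0.
  have wa0 : 0 <= a / (a + b) by rewrite divr_ge0// ltW.
  have wb0 : 0 <= b / (a + b) by rewrite divr_ge0// ltW.
  rewrite (powRM _ (ltW ab)); last by apply: addr_ge0; apply: mulr_ge0.
  rewrite ler_wpM2l ?powR_ge0//.
  pose c (j : 'I_2) := if j == 0 then a / (a + b) else b / (a + b).
  pose x (j : 'I_2) := if j == 0 then s i / a else t i / b.
  have := @powR_jensen r 2 c x r1.
  rewrite !big_ord_recl !big_ord0 /c /x /= !addr0; apply.
  - by move=> j; case: ifP.
  - by move=> j; case: ifP.
  - by rewrite -mulrDl mulfV.
rewrite -[leRHS]mulr1 ler_wpM2l ?powR_ge0// big_split /=.
have pull (u : 'I_n -> R) d : 0 <= d -> d `^ r = \sum_i u i `^ r ->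
    (forall i, 0 <= u i) -> \sum_i d / (a + b) * (u i / d) `^ r <= d / (a + b).
  move=> d0 dE u0; rewrite -mulr_sumr mulrAC ler_pM2r ?invr_gt0//.
  exact: normalized.
by rewrite -[leRHS](mulfV abn0) mulrDl lerD// pull.
Qed.

Lemma pnorm_le1 p n (s : 'I_n -> R) : (1 <= p)%E ->
  (forall i, 0 <= s i) -> (forall i, s i <= 1) -> pnorm p s <= pow_inv_p p n%:R.
Proof.
move=> p1 s0 s1; apply: le_trans (pnorm_le p1 s0 s1) _.
case: p p1 => [r||]//= p1; last by rewrite bigmax_le.
by under eq_bigr do rewrite powR1; rewrite sumr_const card_ord.
Qed.

End VectorNorm.

(** * Contractions and the singular value decomposition *)

Section Contractions.
Variable R : realType.
Local Notation C := R[i].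
Local Notation "x %:C" := (real_complex R x) : ring_scope.

Lemma ctrE m n (M : 'M[C]_(m, n)) i j : ctr M i j = (M j i)^*.
Proof. by rewrite !mxE. Qed.

Lemma ctrK m n (M : 'M[C]_(m, n)) : ctr (ctr M) = M.
Proof. by apply/matrixP => i j; rewrite !ctrE conjCK. Qed.

Lemma ctrM m n k (A : 'M[C]_(m, n)) (B : 'M[C]_(n, k)) :
  ctr (A *m B) = ctr B *m ctr A.
Proof. by rewrite /ctr map_mxM trmx_mul. Qed.

Lemma ctr1 n : ctr (1%:M : 'M[C]_n) = 1%:M.
Proof. by rewrite /ctr map_mx1 trmx1. Qed.

Lemma ctrB m n (A B : 'M[C]_(m, n)) : ctr (A - B) = ctr A - ctr B.
Proof. by apply/matrixP => i j; rewrite ctrE !mxE rmorphB. Qed.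

Lemma ctrN m n (A : 'M[C]_(m, n)) : ctr (- A) = - ctr A.
Proof. by apply/matrixP => i j; rewrite ctrE !mxE rmorphN. Qed.

Definition sqn n (x : 'cV[C]_n) : C := (ctr x *m x) 0 0.

Lemma sqnE n (x : 'cV[C]_n) : sqn x = \sum_i `|x i 0| ^+ 2.
Proof. by rewrite /sqn mxE; apply: eq_bigr => i _; rewrite ctrE normCKC. Qed.

Lemma sqn_ge0 n (x : 'cV[C]_n) : 0 <= sqn x.
Proof. by rewrite sqnE; apply: sumr_ge0 => i _; rewrite exprn_ge0. Qed.

(** Stated through vectors and for rectangular matrices, so that products are immediate and no
    operator norm is involved. *)
Definition contraction m n (P : 'M[C]_(m, n)) : Prop :=
  forall x, sqn (P *m x) <= sqn x.

Lemma contraction_mul m n k (P : 'M[C]_(m, n)) (Q : 'M[C]_(n, k)) :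
  contraction P -> contraction Q -> contraction (P *m Q).
Proof. by move=> cP cQ x; rewrite -mulmxA; apply: le_trans (cP _) (cQ _). Qed.

(* With [z = P^* y], expanding [0 <= |y - P z|^2] gives
   [2 |z|^2 <= |y|^2 + |P z|^2 <= |y|^2 + |z|^2]. *)
Lemma contraction_ctr m n (P : 'M[C]_(m, n)) :
  contraction P -> contraction (ctr P).
Proof.
move=> cP y; set z := ctr P *m y.
have : 0 <= sqn (y - P *m z) by exact: sqn_ge0.
have -> : sqn (y - P *m z) = sqn y - sqn z - (sqn z - sqn (P *m z)).
  rewrite /sqn ctrB mulmxBl !mulmxBr.
  have -> : ctr y *m (P *m z) = ctr z *m z by rewrite mulmxA ctrM ctrK.
  have -> : ctr (P *m z) *m y = ctr z *m z by rewrite ctrM -mulmxA.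
  by rewrite !mxE.
rewrite subr_ge0 => le_yz; rewrite -subr_ge0; apply: le_trans le_yz.
by rewrite subr_ge0; exact: cP.
Qed.

(** Common source of contractions: isometries, diagonal matrices and the partial isometry of the
    singular value decomposition all have a diagonal Gram matrix. *)
Lemma contraction_gram_diag m n (P : 'M[C]_(m, n)) (d : 'rV[C]_n) :
  ctr P *m P = diag_mx d -> (forall i, d 0 i <= 1) -> contraction P.
Proof.
move=> gramP d1 x.
have -> : sqn (P *m x) = \sum_i d 0 i * `|x i 0| ^+ 2.
  rewrite /sqn ctrM -mulmxA [ctr P *m _]mulmxA gramP mxE.
  by apply: eq_bigr => i _; rewrite mul_diag_mx ctrE !mxE mulrCA normCKC.
by rewrite sqnE; apply: ler_sum => i _; rewrite ler_piMl// exprn_ge0.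
Qed.

Lemma contraction_isometry m n (P : 'M[C]_(m, n)) :
  ctr P *m P = 1%:M -> contraction P.
Proof.
move=> P1; apply: (@contraction_gram_diag _ _ _ (const_mx 1)) => [|i].
  by rewrite diag_const_mx.
by rewrite mxE.
Qed.

Lemma contraction1 n : contraction (1%:M : 'M[C]_n).
Proof. by apply: contraction_isometry; rewrite ctr1 mul1mx. Qed.

Lemma contractionN1 n : contraction (- 1%:M : 'M[C]_n).
Proof.
by apply: contraction_isometry; rewrite ctrN ctr1 mulNmx mul1mx opprK.
Qed.

Lemma contraction_diag n (d : 'rV[C]_n) :
  (forall i, `|d 0 i| <= 1) -> contraction (diag_mx d).
Proof.
move=> d1; apply: (@contraction_gram_diag _ _ _ (\row_i (`|d 0 i| ^+ 2))) => [|i].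
  apply/matrixP => i j; rewrite mul_mx_diag [LHS]mxE ctrE !mxE eq_sym.
  by case: eqP => [->|_]; rewrite ?mulr1n ?normCKC// mulr0n conjC0 mul0r.
by rewrite mxE expr_le1.
Qed.

(** Column [j] is the image of a unit basis vector. These sums feed the substochastic weights of
    [pnorm_diag_le]. *)
Lemma contraction_col m n (P : 'M[C]_(m, n)) j :
  contraction P -> \sum_i `|P i j| ^+ 2 <= 1.
Proof.
have -> : \sum_i `|P i j| ^+ 2 = sqn (P *m delta_mx j 0).
  by rewrite -colE sqnE; apply: eq_bigr => i _; rewrite mxE.
move=> /(_ (delta_mx j 0)) /le_trans; apply.
rewrite sqnE (bigD1 j)//= big1 => [|i /negPf ij]; rewrite !mxE eqxx ?ij//=.
  by rewrite normr1 expr1n addr0.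
by rewrite normr0 expr0n.
Qed.

Lemma contraction_row m n (P : 'M[C]_(m, n)) i :
  contraction P -> \sum_j `|P i j| ^+ 2 <= 1.
Proof.
move=> /contraction_ctr/(@contraction_col _ _ _ i); apply: le_trans.
by apply: ler_sum => j _; rewrite ctrE norm_conjC.
Qed.

Lemma contraction_entry m n (P : 'M[C]_(m, n)) i j :
  contraction P -> `|P i j| <= 1.
Proof.
move=> /(@contraction_col _ _ _ j); rewrite (bigD1 i)//= => h.
have : `|P i j| ^+ 2 <= 1.
  by apply: le_trans h; rewrite lerDl sumr_ge0// => k _; rewrite exprn_ge0.
by rewrite expr_le1.
Qed.

Lemma char_poly_conj (F : comNzRingType) n (P D Q : 'M[F]_n) : P *m Q = 1%:M ->
  char_poly (P *m D *m Q) = char_poly D.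
Proof.
move=> PQ; pose f := map_mx (polyC (R := F)).
have fPQ : f n n P *m f n n Q = 1%:M by rewrite -map_mxM PQ map_mx1.
rewrite /char_poly.
have -> : char_poly_mx (P *m D *m Q) = f n n P *m char_poly_mx D *m f n n Q.
  rewrite /char_poly_mx mulmxBr mulmxBl -/(f n n _) /f !map_mxM; congr (_ - _).
  by rewrite -mulmxA -scalar_mxC mulmxA fPQ mul1mx.
by rewrite !det_mulmx mulrAC -det_mulmx fPQ det1 mul1r.
Qed.

(** [gram_eigs] lists the roots in an unspecified order, hence a conclusion up to permutation. It
    follows from uniqueness of the factorization into linear polynomials. *)
Lemma gram_eigs_perm n (M V : 'M[C]_n) (d : 'rV[C]_n) :
  V *m ctr V = 1%:M -> ctr V *m (ctr M *m M) *m V = diag_mx d ->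
  perm_eq (gram_eigs M) [seq d 0 i | i <- enum 'I_n].
Proof.
move=> VV diagM; rewrite /gram_eigs; case: closed_field_poly_normal => r /=.
have -> : char_poly (ctr M *m M) =
    \prod_(x <- [seq d 0 i | i <- enum 'I_n]) ('X - x%:P).
  rewrite -(@char_poly_conj _ _ (ctr V) _ V) ?diagM; last exact: mulmx1C.
  rewrite char_poly_trig ?diag_mx_is_trig//.
  rewrite big_map big_enum /=.
  by apply: eq_bigr => i _; rewrite mxE eqxx mulr1n.
rewrite (monicP (monic_prod_XsubC _ _ _)) scale1r => rE.
by rewrite perm_sym; apply: prod_XsubC_eq.
Qed.

(** Spectral theorem for [M^* M]. The factor [X] is only a partial isometry: being a contraction is
    all that is used later, and no orthonormal basis has to be completed. *)
Lemma svd n (M : 'M[C]_n) : exists (X W : 'M[C]_n) (s : 'I_n -> R),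
  (forall i, 0 <= s i) /\
  [/\ contraction X, contraction W,
      M = X *m diag_mx (\row_i (s i)%:C) *m W,
      diag_mx (\row_i (s i)%:C) = ctr X *m M *m ctr W &
      perm_eq (sing_vals M) [seq s i | i <- enum 'I_n]].
Proof.
set G := ctr M *m M.
have Gherm : ctr G = G by rewrite /G ctrM ctrK.
have normalG : G \is normalmx.
  by apply/normalmxP; rewrite -map_trmx -/(ctr G) Gherm.
have /orthomx_spectralP := normalG.
have := spectral_unitarymx G; move: (spectralmx G) (spectral_diag G) => W d.
move=> W_unitary; rewrite invmx_unitary//; move/unitarymxP: W_unitary.
rewrite -map_trmx -/(ctr W) => WW GE.
have WW' : ctr W *m W = 1%:M by exact: mulmx1C.
have gram : ctr (M *m ctr W) *m (M *m ctr W) = diag_mx d.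
  rewrite ctrM ctrK -!mulmxA [ctr M *m _]mulmxA -/G GE.
  by rewrite -!mulmxA WW mulmx1 mulmxA WW mul1mx.
have dE i : d 0 i = sqn (col i (M *m ctr W)).
  have /matrixP/(_ i i) := gram; rewrite [RHS]mxE eqxx mulr1n => <-.
  by rewrite sqnE mxE; apply: eq_bigr => k _; rewrite ctrE [in RHS]mxE normCKC.
have d0 i : 0 <= d 0 i by rewrite dE sqn_ge0.
pose s i := Num.sqrt (complex.Re (d 0 i)).
have sd i : d 0 i = (s i ^+ 2)%:C.
  rewrite sqr_sqrtr; first by rewrite RRe_real// ger0_real.
  by have := d0 i; rewrite lecE => /andP[].
(* Since the inverse of [0] is [0], the columns of [X] at zero singular values vanish. *)
pose X := M *m ctr W *m diag_mx (\row_i ((s i)^-1)%:C).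
have gramX : ctr X *m X = diag_mx (\row_i (s i != 0)%:R).
  rewrite /X ctrM -mulmxA [ctr (M *m _) *m _]mulmxA gram.
  apply/matrixP => i j; rewrite mulmx_diag mul_mx_diag [LHS]mxE ctrE !mxE eq_sym.
  case: eqP => [->|_]; last by rewrite !mulr0n conjC0 mul0r.
  rewrite !mulr1n sd; case: eqVneq => [->|sn0] /=.
    by rewrite invr0 !rmorph0 !mulr0.
  rewrite conj_Creal; last by apply/complex_realP; exists (s j)^-1.
  rewrite -!rmorphM /= -[RHS](rmorph1 (real_complex R)); congr (_%:C).
  by field.
have MWE : X *m diag_mx (\row_i (s i)%:C) = M *m ctr W.
  apply/matrixP => i j; rewrite /X -mulmxA mulmx_diag mul_mx_diag !mxE.
  rewrite -rmorphM; case: (eqVneq (s j) 0) => [sj0|sn0]; last first.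
    by rewrite mulVf// rmorph1 mulr1.
  rewrite sj0 mulr0 rmorph0 mulr0.
  (* A zero singular value makes the whole column of [M *m ctr W] vanish, since [d 0 j] is its
     squared length. *)
  have : sqn (col j (M *m ctr W)) = 0 by rewrite -dE sd sj0 expr0n rmorph0.
  rewrite sqnE => /eqP; rewrite psumr_eq0; last by move=> k _; rewrite exprn_ge0.
  move=> /allP/(_ i); rewrite mem_index_enum sqrf_eq0 normr_eq0 !mxE.
  by move=> /(_ erefl)/eqP.
exists X, W, s; split; first by move=> i; exact: sqrtr_ge0.
split.
- apply: contraction_gram_diag gramX _ => i; rewrite mxE; case: eqP => //=.
- exact: contraction_isometry.
- by rewrite MWE -mulmxA WW' mulmx1.
- rewrite -mulmxA -MWE mulmxA gramX mulmx_diag; congr diag_mx.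
  apply/rowP => i; rewrite !mxE; case: eqVneq => [->|_]; last by rewrite mul1r.
  by rewrite rmorph0 mulr0.
- rewrite /sing_vals (_ : [seq s i | i <- enum 'I_n] =
    [seq Num.sqrt (complex.Re z) | z <- [seq d 0 i | i <- enum 'I_n]]).
    apply: perm_map; apply: (@gram_eigs_perm _ _ (ctr W)) => //.
      by rewrite ctrK.
    by rewrite -gram ctrM ctrK !mulmxA.
  rewrite -[RHS]map_comp.
  exact: eq_map.
Qed.

End Contractions.

(** * Schatten norms *)

Section Schatten.
Variable R : realType.
Local Notation C := R[i].
Local Notation "x %:C" := (real_complex R x) : ring_scope.

(** The norm on [C] takes values in [C]; this is its real-valued copy, to which [pnorm] applies. *)
Definition modulus (z : C) : R := complex.Re `|z|.

Lemma modulusE z : (modulus z)%:C = `|z|.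
Proof. by rewrite /modulus RRe_real// normr_real. Qed.

Lemma modulus_ge0 z : 0 <= modulus z.
Proof. by rewrite -lecR modulusE normr_ge0. Qed.

Lemma modulusM x y : modulus (x * y) = modulus x * modulus y.
Proof. by apply: complexI; rewrite rmorphM /= !modulusE normrM. Qed.

Lemma modulusD x y : modulus (x + y) <= modulus x + modulus y.
Proof. by rewrite -lecR rmorphD /= !modulusE ler_normD. Qed.

Lemma modulus_sum (I : finType) (F : I -> C) :
  modulus (\sum_i F i) <= \sum_i modulus (F i).
Proof.
rewrite -lecR rmorph_sum /= modulusE; apply: le_trans (ler_norm_sum _ _ _) _.
by apply: ler_sum => i _; rewrite modulusE.
Qed.

Lemma modulus_real (x : R) : 0 <= x -> modulus x%:C = x.
Proof. by move=> x0; apply: complexI; rewrite modulusE ger0_norm ?ler0c. Qed.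

Lemma modulus_conj z : modulus z^* = modulus z.
Proof. by apply: complexI; rewrite !modulusE norm_conjC. Qed.

Lemma modulus_sqr_sum_le1 (I : finType) (F : I -> C) :
  \sum_i `|F i| ^+ 2 <= 1 -> \sum_i modulus (F i) ^+ 2 <= 1.
Proof.
move=> h; rewrite -lecR rmorph_sum rmorph1; apply: le_trans h.
by apply: ler_sum => i _; rewrite rmorphXn /= modulusE.
Qed.

Variable p : \bar R.
Hypothesis p1 : (1 <= p)%E.

Lemma schatten_pnorm n (M : 'M[C]_n) (s : 'I_n -> R) :
  perm_eq (sing_vals M) [seq s i | i <- enum 'I_n] -> schatten p M = pnorm p s.
Proof.
move=> sM; rewrite /schatten /pnorm; case: p => [r||];
  by rewrite (perm_big _ sM) big_map big_enum.
Qed.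

(* By the singular value decomposition [M = X diag(s) W], the [i]-th diagonal
   entry is [\sum_j a_ij s_j b_ji] with [a = P X] and [b = W Q] contractions, and
   the weights [(|a_ij|^2 + |b_ji|^2) / 2] are doubly substochastic. *)
Lemma pnorm_diag_le m n (M : 'M[C]_n) (P : 'M[C]_(m, n)) (Q : 'M[C]_(n, m)) :
  contraction P -> contraction Q ->
  pnorm p (fun i => modulus ((P *m M *m Q) i i)) <= schatten p M.
Proof.
move=> cP cQ; have [X [W [s [s0 [cX cW ME _ sM]]]]] := svd M.
rewrite (schatten_pnorm sM).
have := contraction_mul cP cX; have := contraction_mul cW cQ.
set a := P *m X; set b := W *m Q => cb ca.
have -> : P *m M *m Q = a *m diag_mx (\row_i (s i)%:C) *m b.
  by rewrite [in LHS]ME /a /b !mulmxA.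
have half_le1 (x y : R) : x <= 1 -> y <= 1 -> (x + y) / 2 <= 1 by lra.
apply: (@pnorm_substochastic _ _ _ _ _ _
  (fun i j => (modulus (a i j) ^+ 2 + modulus (b j i) ^+ 2) / 2)) => //.
- by move=> i; exact: modulus_ge0.
- by move=> i j; rewrite divr_ge0// addr_ge0// exprn_ge0// modulus_ge0.
- move=> i; rewrite -mulr_suml big_split /=; apply: half_le1.
    exact/modulus_sqr_sum_le1/contraction_row.
  exact/modulus_sqr_sum_le1/contraction_col.
- move=> j; rewrite -mulr_suml big_split /=; apply: half_le1.
    exact/modulus_sqr_sum_le1/contraction_col.
  exact/modulus_sqr_sum_le1/contraction_row.
- move=> i; rewrite mxE; apply: le_trans (modulus_sum _) _.
  apply: ler_sum => j _; rewrite mul_mx_diag !mxE !modulusM modulus_real//.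
  rewrite mulrAC ler_wpM2r//.
  (* The inequality [x * y <= (x^2 + y^2) / 2] is the origin of the averaged weights. *)
  move: (modulus _) (modulus _) => x y; have := sqr_ge0 (x - y); nra.
Qed.

(** The adjoints of the singular factors attain equality in [pnorm_diag_le]. The main norm
    properties below start from such an optimal pair [P], [Q]. *)
Lemma schatten_diag n (M : 'M[C]_n) : exists P Q : 'M[C]_n,
  [/\ contraction P, contraction Q &
      schatten p M = pnorm p (fun i => modulus ((P *m M *m Q) i i))].
Proof.
have [X [W [s [s0 [cX cW _ sE sM]]]]] := svd M.
exists (ctr X), (ctr W); split; [exact: contraction_ctr..|].
rewrite (schatten_pnorm sM) -sE; congr pnorm; apply/funext => i.
by rewrite !mxE eqxx mulr1n modulus_real.
Qed.

Lemma schatten_ge0 n (M : 'M[C]_n) : 0 <= schatten p M.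
Proof. by have [P [Q [_ _ ->]]] := schatten_diag M; exact: pnorm_ge0. Qed.

(** [P' *m P] and [Q *m Q'] are again contractions. The sizes may differ, so this covers both
    cutting out a block and padding it with zeros. *)
Lemma schatten_compress m n (M : 'M[C]_n) (P : 'M[C]_(m, n)) (Q : 'M[C]_(n, m)) :
  contraction P -> contraction Q -> schatten p (P *m M *m Q) <= schatten p M.
Proof.
move=> cP cQ; have [P' [Q' [cP' cQ' ->]]] := schatten_diag (P *m M *m Q).
have -> : P' *m (P *m M *m Q) *m Q' = (P' *m P) *m M *m (Q *m Q').
  by rewrite !mulmxA.
by apply: pnorm_diag_le; apply: contraction_mul.
Qed.

(** An optimal pair for [M + N] is admissible for [M] and for [N]; Minkowski concludes. *)
Lemma schattenD n (M N : 'M[C]_n) :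
  schatten p (M + N) <= schatten p M + schatten p N.
Proof.
have [P [Q [cP cQ ->]]] := schatten_diag (M + N).
apply: le_trans (lerD (pnorm_diag_le M cP cQ) (pnorm_diag_le N cP cQ)).
have mge0 z : 0 <= modulus z := modulus_ge0 z.
apply: le_trans (pnormD p1 _ _) => //; apply: pnorm_le => // i.
by rewrite mulmxDr mulmxDl mxE modulusD.
Qed.

(** The diagonal of [P N^* Q] is conjugate to that of [Q^* N P^*]. One inequality suffices because
    [ctr] is an involution. *)
Lemma schatten_ctr n (M : 'M[C]_n) : schatten p (ctr M) = schatten p M.
Proof.
suff le_ctr (N : 'M[C]_n) : schatten p (ctr N) <= schatten p N.
  apply: le_anti; apply/andP; split; first exact: le_ctr.
  by rewrite -{1}[M]ctrK; exact: le_ctr.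
have [P [Q [cP cQ ->]]] := schatten_diag (ctr N).
apply: le_trans (pnorm_diag_le N (contraction_ctr cQ) (contraction_ctr cP)).
apply: pnorm_le => // i; first exact: modulus_ge0.
by rewrite -(modulus_conj (_ i i)) -ctrE !ctrM !ctrK mulmxA.
Qed.

(** Each singular value is at most the p-norm of all of them, so the decomposition can be rescaled.
    If that norm is [0], then [M] is [0] and the convention on inverses gives [K = 0]. *)
Lemma schatten_scaled_contraction n (M : 'M[C]_n) :
  exists2 K : 'M[C]_n, contraction K & M = (schatten p M)%:C *: K.
Proof.
have [X [W [s [s0 [cX cW ME _ sM]]]]] := svd M.
rewrite (schatten_pnorm sM); set c := pnorm p s.
have sc i : s i <= c by exact: le_pnorm.
have c0 : 0 <= c by exact: pnorm_ge0.
exists (X *m diag_mx (\row_i (s i / c)%:C) *m W).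
  apply: contraction_mul => //; apply: contraction_mul => //.
  apply: contraction_diag => i; rewrite mxE -modulusE modulus_real ?divr_ge0//.
  rewrite -(rmorph1 (real_complex R)) lecR.
  have [->|cn0] := eqVneq c 0; first by rewrite invr0 mulr0.
  by rewrite ler_pdivrMr ?mul1r// lt_def cn0.
rewrite {1}ME scalemxAl scalemxAr; congr (_ *m _ *m _).
apply/matrixP => i j; rewrite !mxE; case: eqP => [_|]; last by rewrite mulr0.
rewrite !mulr1n -rmorphM /=; congr (_%:C).
have [cz|cn0] := eqVneq c 0; last by rewrite mulrC divfK.
by rewrite cz mul0r; apply/eqP; rewrite eq_le s0 -[X in _ <= X]cz sc.
Qed.

(** With [M = c K], the contraction [K] is absorbed into the left factor of an optimal pair. *)
Lemma schatten_mul n (M N : 'M[C]_n) :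
  schatten p (M *m N) <= schatten p M * schatten p N.
Proof.
have [K cK ME] := schatten_scaled_contraction M.
rewrite [in leLHS]ME; have := schatten_ge0 M; move: (schatten p M) => c c0.
have [P [Q [cP cQ ->]]] := schatten_diag ((c%:C *: K) *m N).
have -> : (fun i => modulus ((P *m ((c%:C *: K) *m N) *m Q) i i)) =
    (fun i => c * modulus (((P *m K) *m N *m Q) i i)).
  apply/funext => i; rewrite -scalemxAl -scalemxAr -scalemxAl mxE modulusM.
  by rewrite modulus_real// !mulmxA.
rewrite pnormZ// => [|i]; last exact: modulus_ge0.
by rewrite ler_wpM2l// pnorm_diag_le//; exact: contraction_mul.
Qed.

(** Every diagonal entry of [P *m M *m Q] has modulus at most [1], and a vector of [n] ones has
    p-norm [n^(1/p)]. *)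
Lemma schatten_contraction n (M : 'M[C]_n) :
  contraction M -> schatten p M <= pow_inv_p p n%:R.
Proof.
move=> cM; have [P [Q [cP cQ ->]]] := schatten_diag M.
apply: pnorm_le1 => // i; first exact: modulus_ge0.
rewrite -lecR modulusE; apply: contraction_entry.
by apply: contraction_mul => //; apply: contraction_mul.
Qed.

Lemma schatten0 n : schatten p (0 : 'M[C]_n) = 0.
Proof.
have [P [Q [_ _ ->]]] := schatten_diag (0 : 'M[C]_n).
have -> : (fun i => modulus ((P *m 0 *m Q) i i)) = (fun i => 0 * 0).
  by apply/funext => i; rewrite mulmx0 mul0mx mxE mul0r modulus_real.
by rewrite pnormZ// mul0r.
Qed.

Lemma schatten_sum (I : finType) n (F : I -> 'M[C]_n) :
  schatten p (\sum_i F i) <= \sum_i schatten p (F i).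
Proof.
elim/big_rec2: _ => [|i x M _ le_Mx]; first by rewrite schatten0.
by apply: le_trans (schattenD _ _) _; rewrite lerD2l.
Qed.

Lemma schatten_gt0 n (M : 'M[C]_n) : M != 0 -> 0 < schatten p M.
Proof.
rewrite lt_def schatten_ge0 andbT; apply: contra_neq => M0.
by have [K _ ->] := schatten_scaled_contraction M; rewrite M0 scale0r.
Qed.

End Schatten.

(** * Block triangular factorizations *)

Section BlockLU.
Variable R : realType.
Local Notation C := R[i].

(** The projection [P_k] is the case where [m] is the boundary [b_k]: [m] counts coordinates, not
    blocks. *)
Definition tail_proj n (m : nat) : 'M[C]_n := diag_mx (\row_i (m <= i)%N%:R).

(** Embedding of [s] consecutive coordinates starting at [r], an isometry when [r + s <= n]. It
    turns submatrices into compressions. *)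
Definition block_incl n (r s : nat) : 'M[C]_(n, s) :=
  \matrix_(i, j) (i == (r + j)%N :> nat)%:R.

Lemma tail_projM n m (M : 'M[C]_n) i j :
  (tail_proj n m *m M) i j = (m <= i)%N%:R * M i j.
Proof. by rewrite mul_diag_mx !mxE. Qed.

Lemma mulmx_tail_proj n m (M : 'M[C]_n) i j :
  (M *m tail_proj n m) i j = M i j * (m <= j)%N%:R.
Proof. by rewrite mul_mx_diag !mxE. Qed.

Lemma tail_proj0 n : tail_proj n 0 = 1%:M.
Proof. by apply/matrixP => i j; rewrite !mxE leq0n. Qed.

Lemma tail_projn n : tail_proj n n = 0.
Proof. by apply/matrixP => i j; rewrite !mxE leqNgt ltn_ord mul0rn. Qed.

Lemma tail_proj_mul n m m' : (m <= m')%N ->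
  tail_proj n m *m tail_proj n m' = tail_proj n m'.
Proof.
move=> mm'; rewrite mulmx_diag; congr diag_mx; apply/rowP => i; rewrite !mxE.
have [m'i|] := leqP m' i; last by rewrite mulr0.
by rewrite (leq_trans mm' m'i) mul1r.
Qed.

Lemma tail_proj_mulC n m m' :
  tail_proj n m *m tail_proj n m' = tail_proj n m' *m tail_proj n m.
Proof. exact: diag_mxC. Qed.

Lemma entE n (M : 'M[C]_n) (i j : 'I_n) : ent M i j = M i j.
Proof. by rewrite /ent !valK. Qed.

Lemma ctr_block_inclM n k r s (M : 'M[C]_(n, k)) (i : 'I_s) j
    (ri : (r + i < n)%N) :
  (ctr (block_incl n r s) *m M) i j = M (Ordinal ri) j.
Proof.
rewrite mxE (bigD1 (Ordinal ri))//= big1 ?addr0 => [|t /negPf ti].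
  by rewrite ctrE mxE eqxx conjC1 mul1r.
rewrite ctrE mxE (_ : (t == (r + i)%N :> nat) = false) ?conjC0 ?mul0r//.
Qed.

Lemma mulmx_block_incl n k r s (M : 'M[C]_(k, n)) i (j : 'I_s)
    (rj : (r + j < n)%N) :
  (M *m block_incl n r s) i j = M i (Ordinal rj).
Proof.
rewrite mxE (bigD1 (Ordinal rj))//= big1 ?addr0 => [|t /negPf tj].
  by rewrite mxE eqxx mulr1.
rewrite mxE (_ : (t == (r + j)%N :> nat) = false) ?mulr0//.
Qed.

Lemma submE n (M : 'M[C]_n) r c m1 m2 : (r + m1 <= n)%N -> (c + m2 <= n)%N ->
  subm M r c m1 m2 = ctr (block_incl n r m1) *m M *m block_incl n c m2.
Proof.
move=> rn cn; apply/matrixP => i j.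
have ri : (r + i < n)%N by apply: leq_trans rn; rewrite ltn_add2l.
have cj : (c + j < n)%N by apply: leq_trans cn; rewrite ltn_add2l.
rewrite (mulmx_block_incl _ _ cj) (ctr_block_inclM _ _ ri) mxE.
exact: (@entE _ M (Ordinal ri) (Ordinal cj)).
Qed.

Lemma block_incl_isometry n r s : (r + s <= n)%N ->
  ctr (block_incl n r s) *m block_incl n r s = 1%:M.
Proof.
move=> rs; apply/matrixP => i j.
have ri : (r + i < n)%N by apply: leq_trans rs; rewrite ltn_add2l.
by rewrite (ctr_block_inclM _ _ ri) !mxE /= eqn_add2l.
Qed.

Lemma block_incl_proj n r s : (r + s <= n)%N ->
  block_incl n r s *m ctr (block_incl n r s) =
  tail_proj n r - tail_proj n (r + s).
Proof.
move=> rs; apply/matrixP => i j; rewrite !mxE -mulrnBl.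
under eq_bigr do rewrite ctrE !mxE conjC_nat -natrM mulnb.
have [ir|ri] := ltnP i r.
  rewrite leqNgt (leq_trans ir (leq_addr _ _))/= subrr mul0rn big1// => t _.
  by rewrite (ltn_eqF (leq_trans ir (leq_addr _ _))).
have [irs|rsi] := ltnP i (r + s)%N; last first.
  rewrite subrr mul0rn big1// => t _; rewrite (gtn_eqF (leq_trans _ rsi))//.
  by rewrite ltn_add2l.
rewrite subr0; have tP : (i - r < s)%N by rewrite ltn_subLR.
rewrite (bigD1 (Ordinal tP))//= subnKC// eqxx /= big1 ?addr0 => [|t tP'].
  by rewrite eq_sym.
case: eqP => //= it; case/eqP: tP'; apply: val_inj => /=.
by rewrite it addKn.
Qed.

Lemma contraction_block_incl n r s : (r + s <= n)%N ->
  contraction (block_incl n r s).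
Proof. by move=> /block_incl_isometry/contraction_isometry. Qed.

(** * Projections of a blocking, and the identities for block rows and columns *)

Section Blocking.
Variables (n nt : nat) (b : seq nat).
Hypothesis blk : blocking n nt b.
Local Notation bd := (nth 0%N b).
Local Notation P k := (tail_proj n (bd k)).
Local Notation E k := (P k - P k.+1).

Lemma blocking_ltn k k' : (k < k' <= nt)%N -> (bd k < bd k')%N.
Proof.
case: blk => sb sorted_b _ _ /andP[kk' k'nt].
apply: (sorted_ltn_nth ltn_trans) => //; rewrite inE sb ltnS//.
by apply: leq_trans (ltnW kk') k'nt.
Qed.

Lemma blocking_le k : (k <= nt)%N -> (bd k <= n)%N.
Proof.
case: (blk) => _ _ _ <-; rewrite leq_eqVlt => /predU1P[->//|knt].
by rewrite ltnW// blocking_ltn// knt /=.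
Qed.

(** Telescoping from [P_0 = 1] to [P_nt = 0]. This splits [L] into block columns and [U] into block
    rows. *)
Lemma blocking_sum : \sum_(k < nt) E k = 1%:M.
Proof.
rewrite -(big_mkord xpredT (fun k => E k)).
under eq_bigr do rewrite -opprB.
rewrite sumrN telescope_sumr//; case: blk => _ _ -> ->.
by rewrite tail_proj0 tail_projn sub0r opprK.
Qed.

Lemma block_lower_tail (L : 'M[C]_n) k : block_lower nt b L -> (k <= nt)%N ->
  P k *m (L *m P k) = L *m P k.
Proof.
move=> lowL knt; apply/matrixP => i j; rewrite tail_projM mulmx_tail_proj.
have [_|ik] := leqP (bd k) i; first by rewrite mul1r.
have [kj|_] := leqP (bd k) j; last by rewrite !mulr0.
by rewrite (lowL k) ?ik ?mul0r ?mulr0.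
Qed.

Lemma block_upper_tail (U : 'M[C]_n) k : block_upper nt b U -> (k <= nt)%N ->
  P k *m U *m P k = P k *m U.
Proof.
move=> upU knt; apply/matrixP => i j; rewrite mulmx_tail_proj tail_projM.
have [_|jk] := leqP (bd k) j; first by rewrite mulr1.
have [ki|_] := leqP (bd k) i; last by rewrite !mul0r.
by rewrite (upU k) ?jk ?mulr0 ?mul0r.
Qed.

Variables A L U : 'M[C]_n.
Hypothesis A_unit : A \in unitmx.
Hypothesis A_LU : A = L *m U.
Hypothesis lowL : block_lower nt b L.
Hypothesis upU : block_upper nt b U.

(** The subtracted sum cancels the terms [t < b_k] of [A = L U], leaving the part of the product
    that passes through [P_k]. *)
Lemma activeE k : (k <= nt)%N -> let J := block_incl n (bd k) (n - bd k) in
  active b A L U k = ctr J *m (L *m P k *m U) *m J.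
Proof.
move=> knt J; have bkn := blocking_le knt.
apply/matrixP => i j.
have ki (t : 'I_(n - bd k)) : (bd k + t < n)%N by rewrite -ltn_subRL.
rewrite (mulmx_block_incl _ _ (ki j)) (ctr_block_inclM _ _ (ki i)) mxE /=.
rewrite (@entE _ A (Ordinal (ki i)) (Ordinal (ki j))) A_LU mxE.
rewrite (@big_ord_widen _ _ _ _ _ (fun t =>
  ent L (bd k + i) t * ent U t (bd k + j)) bkn).
rewrite mxE (bigID (fun t : 'I_n => (t < bd k)%N)) /=.
under [X in _ - X]eq_bigr => t _ do rewrite (@entE _ L (Ordinal (ki i)) t)
  (@entE _ U t (Ordinal (ki j))).
rewrite addrC addrK [RHS](bigID (fun t : 'I_n => (t < bd k)%N)) /=.
rewrite [X in _ = X + _]big1 => [|t tk].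
  rewrite add0r; apply: eq_bigr => t; rewrite -leqNgt => kt.
  by rewrite mulmx_tail_proj kt mulr1.
by rewrite mulmx_tail_proj leqNgt tk mulr0 mul0r.
Qed.

(** [J *m ctr J] is [P_k], which triangularity absorbs on both sides. *)
Lemma active_embed k : (k <= nt)%N -> let J := block_incl n (bd k) (n - bd k) in
  L *m P k *m U = J *m active b A L U k *m ctr J.
Proof.
move=> knt J; have bkn := blocking_le knt; rewrite activeE// -/J.
have JJ : J *m ctr J = P k.
  by rewrite block_incl_proj subnKC// tail_projn subr0.
have -> : J *m (ctr J *m (L *m P k *m U) *m J) *m ctr J =
    (J *m ctr J) *m (L *m P k *m U) *m (J *m ctr J) by rewrite !mulmxA.
rewrite JJ; have -> : P k *m (L *m P k *m U) *m P k =
    (P k *m (L *m P k)) *m U *m P k by rewrite !mulmxA.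
by rewrite block_lower_tail// -!mulmxA [P k *m (U *m _)]mulmxA block_upper_tail.
Qed.

(* [P L] and [L P] have the same rank and [L P = P L P], so [P] factors as
   [L P Y]; this is what makes [L^-1] block lower triangular as well. *)
Lemma lower_tail_inv k : (k <= nt)%N ->
  L *m P k *m invmx L *m P k = P k.
Proof.
move=> knt; have L_unit : L \in unitmx.
  by move: A_unit; rewrite A_LU unitmx_mul => /andP[].
have trP : (P k)^T = P k by rewrite tr_diag_mx.
(* The rank argument is about row spaces, hence the transposes. *)
have : (P k *m L^T <= P k)%MS.
  apply/submxP; exists (P k *m L^T).
  by apply: trmx_inj; rewrite !trmx_mul trmxK trP block_lower_tail.
move=> /mxrank_leqif_eq[_]; rewrite mxrankMfree ?row_free_unit ?unitmx_tr//.
rewrite eqxx => /esym/andP[_ /submxP[Y PY]].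
have {}PY : P k = L *m P k *m Y^T.
  by rewrite -[LHS]trP [in LHS]PY !trmx_mul trmxK trP.
by rewrite {2}PY !mulmxA mulmxKV// -!mulmxA [P k *m (P k *m _)]mulmxA
  tail_proj_mul// mulmxA -PY.
Qed.

(** The operator [L P_(k+1) U A^-1] equals [L P_(k+1) L^-1]. In [D_k = L E_k - P_(k+1) L E_k] it
    kills the first term, because [P_(k+1) E_k = 0], and fixes the second by [lower_tail_inv]. *)
Lemma block_lower_strict k : (k < nt)%N ->
  P k.+1 *m L *m E k =
  (- 1%:M) *m (L *m P k.+1 *m U *m invmx A) *m (E k *m L *m E k).
Proof.
move=> knt; have /andP[L_unit U_unit] : (L \in unitmx) && (U \in unitmx).
  by rewrite -unitmx_mul -A_LU.
have invA : invmx A = invmx U *m invmx L.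
  apply: (can_inj (mulKmx A_unit)); rewrite mulmxV// A_LU.
  by rewrite -mulmxA [U *m _]mulmxA mulmxV// mul1mx mulmxV.
have -> : L *m P k.+1 *m U *m invmx A = L *m P k.+1 *m invmx L.
  by rewrite invA -[in LHS]mulmxA [U *m _]mulmxA mulmxV// mul1mx.
have bdk : (bd k <= bd k.+1)%N by rewrite ltnW// blocking_ltn// ltnSn.
have PE : P k.+1 *m E k = 0.
  by rewrite mulmxBr tail_proj_mulC !tail_proj_mul// subrr.
have ELE : E k *m L *m E k = L *m E k - P k.+1 *m L *m E k.
  have PkE : P k *m E k = E k by rewrite mulmxBr !tail_proj_mul.
  rewrite [E k *m L]mulmxBl mulmxBl; congr (_ - _).
  by rewrite -PkE !mulmxA -(mulmxA (P k)) block_lower_tail// ltnW.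
move: (E k) PE ELE => e PE ->; rewrite mulNmx mul1mx mulmxBr !mulNmx opprK.
have -> : L *m P k.+1 *m invmx L *m (L *m e) = 0.
  by rewrite -(mulmxA _ (invmx L)) mulKmx// -mulmxA PE mulmx0.
by rewrite oppr0 add0r !mulmxA lower_tail_inv.
Qed.

(** Triangularity gives [E_k L P_k = D_k], so multiplying by [D_k^*] leaves [D_k^* D_k U = E_k U].
    The trailing identity matrix gives the two-sided shape of [schatten_compress]. *)
Lemma block_upper_row k : (k < nt)%N ->
  ctr (E k *m L *m E k) *m (E k *m L *m E k) = E k ->
  E k *m U = ctr (E k *m L *m E k) *m (L *m P k *m U) *m 1%:M.
Proof.
move=> knt DD.
have bdk : (bd k <= bd k.+1)%N by rewrite ltnW// blocking_ltn// ltnSn.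
have EP : E k *m P k.+1 = 0 by rewrite mulmxBl !tail_proj_mul// subrr.
have EE : E k *m E k = E k.
  rewrite [LHS]mulmxBr EP subr0 mulmxBl tail_proj_mul//.
  by rewrite tail_proj_mulC tail_proj_mul.
have ELP : E k *m L *m P k = E k *m L *m E k.
  rewrite mulmxBr -(mulmxA _ L (P k.+1)) -(block_lower_tail lowL knt).
  by rewrite mulmxA EP mul0mx subr0.
have trE : ctr (E k) = E k.
  apply/matrixP => i j; rewrite ctrE !mxE -!mulrnA rmorphB /= !conjC_nat.
  by rewrite eq_sym; case: eqP => [->|_]; rewrite ?muln1// !muln0.
have : E k *m (E k *m L *m E k) = E k *m L *m E k by rewrite !mulmxA EE.
move: (E k *m L *m E k) DD ELP => D DD ELP ED.
have ctrDE : ctr D *m E k = ctr D by rewrite -[X in _ *m X]trE -ctrM ED.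
have -> : ctr D *m (L *m P k *m U) = ctr D *m (E k *m L *m P k) *m U.
  by rewrite -[in LHS]ctrDE !mulmxA.
by rewrite ELP DD mulmx1.
Qed.

(** * Norm bounds when the diagonal blocks of [L] are unitary *)

Section Bounds.
Variables (p : \bar R) (rho : R).
Hypothesis p1 : (1 <= p)%E.
Hypothesis rho0 : 0 <= rho.
Hypothesis rhoP : forall k, (k < nt)%N ->
  schatten p (active b A L U k) <= rho * schatten p A.
Hypothesis L_unitary : forall k, (k < nt)%N ->
  unitary (subm L (bd k) (bd k) (bd k.+1 - bd k) (bd k.+1 - bd k)).

(** Conjugation by [J] carries unitarity of [Lkk] to the full space, where [J *m ctr J] is [E_k]. *)
Lemma diag_block k : (k < nt)%N ->
  let J := block_incl n (bd k) (bd k.+1 - bd k) in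
  let Lkk := subm L (bd k) (bd k) (bd k.+1 - bd k) (bd k.+1 - bd k) in
  [/\ E k *m L *m E k = J *m Lkk *m ctr J, contraction J &
      ctr (E k *m L *m E k) *m (E k *m L *m E k) = E k].
Proof.
move=> knt J Lkk.
have bdk : (bd k <= bd k.+1)%N by rewrite ltnW// blocking_ltn// ltnSn.
have bdn : (bd k + (bd k.+1 - bd k) <= n)%N by rewrite subnKC// blocking_le.
have JJ : J *m ctr J = E k by rewrite block_incl_proj// subnKC.
have DE : E k *m L *m E k = J *m Lkk *m ctr J.
  by rewrite /Lkk submE// -JJ !mulmxA.
split => //; first exact: contraction_block_incl.
rewrite DE !ctrM ctrK.
have -> : J *m (ctr Lkk *m ctr J) *m (J *m Lkk *m ctr J) =
    J *m (ctr Lkk *m (ctr J *m J) *m Lkk) *m ctr J by rewrite !mulmxA.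
by rewrite block_incl_isometry// mulmx1 L_unitary// mulmx1.
Qed.

Lemma contraction_diag_block k : (k < nt)%N -> contraction (E k *m L *m E k).
Proof.
move=> knt; have [-> cJ _] := diag_block knt.
apply: contraction_mul; last exact: contraction_ctr.
by apply: contraction_mul => //; apply: contraction_isometry; exact: L_unitary.
Qed.

(** A unitary block of size [s] has norm at most [s^(1/p)], and [s] is at most the largest block
    size. *)
Lemma schatten_diag_block k : (k < nt)%N ->
  schatten p (E k *m L *m E k) <= pow_inv_p p (max_block nt b)%:R.
Proof.
move=> knt; have [-> cJ _] := diag_block knt.
apply: le_trans (schatten_compress p1 _ cJ (contraction_ctr cJ)) _.
apply: le_trans (schatten_contraction p1 (contraction_isometry (L_unitary knt))) _.
case: (p) p1 => [r||]//=; rewrite lee_fin => r1.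
apply: le_powR; rewrite ?invr_ge0 ?(le_trans _ r1)// ler_nat.
exact: (@leq_bigmax _ (fun k : 'I_nt => bd k.+1 - bd k)%N (Ordinal knt)).
Qed.

Lemma schatten_padded_active k : (k < nt)%N ->
  schatten p (L *m P k *m U) <= rho * schatten p A.
Proof.
move=> knt; rewrite active_embed 1?ltnW//; apply: le_trans (rhoP knt).
have cJ : contraction (block_incl n (bd k) (n - bd k)).
  by apply: contraction_block_incl; rewrite subnKC// blocking_le// ltnW.
exact: (schatten_compress p1 _ cJ (contraction_ctr cJ)).
Qed.

Lemma schatten_U_le : schatten p U <= nt%:R * rho * schatten p A.
Proof.
rewrite -[in leLHS](mul1mx U) -blocking_sum mulmx_suml.
apply: le_trans (schatten_sum p1 _) _.
apply: (@le_trans _ _ (\sum_(k < nt) rho * schatten p A)); last first.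
  by rewrite sumr_const card_ord -mulrA [leRHS]mulr_natl.
apply: ler_sum => k _; have [_ _ DD] := diag_block (ltn_ord k).
rewrite block_upper_row//; apply: le_trans (schatten_padded_active (ltn_ord k)).
apply: schatten_compress => //; last exact: contraction1.
exact/contraction_ctr/contraction_diag_block.
Qed.

Lemma schatten_L_le : schatten p L <=
  pow_inv_p p (max_block nt b)%:R * nt%:R + nt%:R * rho * kappa p A.
Proof.
have kappa0 : 0 <= kappa p A by rewrite mulr_ge0// schatten_ge0.
rewrite -[in leLHS](mulmx1 L) -blocking_sum mulmx_sumr.
apply: le_trans (schatten_sum p1 _) _.
apply: (@le_trans _ _
  (\sum_(k < nt) (pow_inv_p p (max_block nt b)%:R + rho * kappa p A))); last first.
  by rewrite sumr_const card_ord mulrnDl -mulrA mulr_natr mulr_natl.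
apply: ler_sum => [[k knt] _] /=.
have bdk : (bd k <= bd k.+1)%N by rewrite ltnW// blocking_ltn// ltnSn.
(* [L E_k] is supported on the rows from block [k] on, which split into the diagonal block and the
   rows below it. *)
have -> : L *m E k = E k *m L *m E k + P k.+1 *m L *m E k.
  have PkE : P k *m E k = E k by rewrite mulmxBr !tail_proj_mul.
  rewrite [E k *m L]mulmxBl mulmxBl subrK.
  rewrite -[in LHS]PkE -[in RHS]PkE !mulmxA.
  by rewrite -(mulmxA (P k)) block_lower_tail// ltnW.
apply: le_trans (schattenD p1 _ _) _; apply: lerD; first exact: schatten_diag_block.
(* Below the last block there are no rows. The case is separate since [rhoP] covers only active
   matrices of index below [nt]. *)
move: (knt); rewrite leq_eqVlt => /predU1P[k1nt|k1nt].
  rewrite k1nt; case: (blk) => _ _ _ ->.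
  by rewrite tail_projn !mul0mx schatten0// mulr_ge0.
rewrite block_lower_strict//.
apply: le_trans (schatten_compress p1 _ _ _) _.
- exact: contractionN1.
- exact: contraction_diag_block.
apply: le_trans (schatten_mul p1 _ _) _.
rewrite /kappa mulrA.
by apply: ler_wpM2r; [exact: schatten_ge0 | exact: schatten_padded_active].
Qed.

End Bounds.
End Blocking.
End BlockLU.

(** * Adjoint factorizations and the final bounds *)

Lemma invmx_ctr (R : realType) n (A : 'M[R[i]]_n) :
  invmx (ctr A) = ctr (invmx A).
Proof. by rewrite /ctr -trmx_inv map_invmx. Qed.

Lemma ent_ctr (R : realType) n (M : 'M[R[i]]_n) i j :
  ent (ctr M) i j = (ent M j i)^*.
Proof.
rewrite /ent; case: insubP => [i' _ _|_]; case: insubP => [j' _ _|_];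
  by rewrite ?ctrE ?conjC0.
Qed.

(** Lets the case of unitary blocks in [U] reuse the growth bound of [A], since adjoints keep
    Schatten norms. *)
Lemma active_ctr (R : realType) n (b : seq nat) (A L U : 'M[R[i]]_n) k :
  active b (ctr A) (ctr U) (ctr L) k = ctr (active b A L U k).
Proof.
apply/matrixP => i j; rewrite ctrE !mxE ent_ctr rmorphB rmorph_sum /=.
by congr (_ - _); apply: eq_bigr => t _; rewrite !ent_ctr rmorphM mulrC.
Qed.

Lemma subm_ctr (R : realType) n (M : 'M[R[i]]_n) r c m1 m2 :
  subm (ctr M) r c m1 m2 = ctr (subm M c r m2 m1).
Proof. by apply/matrixP => i j; rewrite ctrE !mxE ent_ctr. Qed.

Lemma growth_ge0 (R : realType) (p : \bar R) n nt b (A L U : 'M[R[i]]_n) :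
  0 <= growth p nt b A L U.
Proof. exact: bigmax_ge_id. Qed.

Lemma schatten_active_le (R : realType) (p : \bar R) n nt b (A L U : 'M[R[i]]_n) k :
  blocking n nt b -> A \in unitmx -> (1 <= p)%E -> (k < nt)%N ->
  schatten p (active b A L U k) <= growth p nt b A L U * schatten p A.
Proof.
move=> blk A_unit p1 knt.
(* A block exists, so [n > 0]; the empty matrix would be both zero and invertible. *)
have n0 : (0 < n)%N.
  apply: leq_ltn_trans (leq0n (nth 0%N b 0)) _; case: (blk) => _ _ _ <-.
  by apply: (blocking_ltn blk); rewrite leqnn (leq_ltn_trans _ knt).
have A0 : A != 0.
  by apply: contraTneq A_unit => ->; rewrite -(prednK n0) unitmxE det0 unitr0.
rewrite -ler_pdivrMr ?schatten_gt0//.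
exact: (@le_bigmax _ _ _ _ (fun k : 'I_nt =>
  schatten p (active b A L U k) / schatten p A) (Ordinal knt)).
Qed.

(** Here [rho] is any bound on the active matrices, so that the growth factor of [A] can also serve
    for the factorization of [A^*]. *)
Lemma schatten_LU_le (R : realType) n nt b (A L U : 'M[R[i]]_n) (p : \bar R)
    (rho : R) :
  blocking n nt b -> A \in unitmx -> (1 <= p)%E -> A = L *m U ->
  block_lower nt b L -> block_upper nt b U -> 0 <= rho ->
  (forall k, (k < nt)%N -> schatten p (active b A L U k) <= rho * schatten p A) ->
  (forall k, (k < nt)%N ->
     unitary (subm L (nth 0%N b k) (nth 0%N b k)
                (nth 0%N b k.+1 - nth 0%N b k) (nth 0%N b k.+1 - nth 0%N b k))) ->
  let nb := max_block nt b in
  [/\ schatten p L <= pow_inv_p p nb%:R * nt%:R + nt%:R * rho * kappa p A,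
      schatten p U <= nt%:R * rho * schatten p A &
      schatten p L * schatten p U <=
        nt%:R ^+ 2 * rho ^+ 2 * kappa p A * schatten p A
        + pow_inv_p p nb%:R * nt%:R ^+ 2 * rho * schatten p A].
Proof.
move=> blk A_unit p1 ALU lowL upU rho0 rhoP L_unitary nb.
have L_le := schatten_L_le blk A_unit ALU lowL upU p1 rho0 rhoP L_unitary.
have U_le := schatten_U_le blk ALU lowL upU p1 rhoP L_unitary.
split => //; apply: le_trans (ler_pM _ _ L_le U_le) _; rewrite ?schatten_ge0//.
by rewrite -/nb le_eqVlt; apply/orP; left; apply/eqP; ring.
Qed.

Theorem theorem2p6 (R : realType) (n nt : nat) (b : seq nat)
  (A L U : 'M[R[i]]_n) (p : \bar R) :
  blocking n nt b ->
  A \in unitmx ->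
  block_strongly_nonsingular nt b A ->
  (1 <= p)%E ->
  block_LU nt b A L U ->
  A = L *m U ->
  let nb := max_block nt b in
  let rho := growth p nt b A L U in
  (* diagonal blocks of L unitary *)
  ((forall k, (k < nt)%N ->
     unitary (subm L (nth 0%N b k) (nth 0%N b k)
                (nth 0%N b k.+1 - nth 0%N b k) (nth 0%N b k.+1 - nth 0%N b k))) ->
    [/\ schatten p L <= pow_inv_p p nb%:R * nt%:R + nt%:R * rho * kappa p A,
        schatten p U <= nt%:R * rho * schatten p A &
        schatten p L * schatten p U <=
          nt%:R ^+ 2 * rho ^+ 2 * kappa p A * schatten p A
          + pow_inv_p p nb%:R * nt%:R ^+ 2 * rho * schatten p A])
  /\
  (* diagonal blocks of U (the paper's R) unitary *)
  ((forall k, (k < nt)%N ->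
     unitary (subm U (nth 0%N b k) (nth 0%N b k)
                (nth 0%N b k.+1 - nth 0%N b k) (nth 0%N b k.+1 - nth 0%N b k))) ->
    [/\ schatten p U <= pow_inv_p p nb%:R * nt%:R + nt%:R * rho * kappa p A,
        schatten p L <= nt%:R * rho * schatten p A &
        schatten p L * schatten p U <=
          nt%:R ^+ 2 * rho ^+ 2 * kappa p A * schatten p A
          + pow_inv_p p nb%:R * nt%:R ^+ 2 * rho * schatten p A]).
Proof.
move=> blk A_unit _ p1 [lowL upU _] ALU nb rho.
have rho0 : 0 <= rho by exact: growth_ge0.
have rhoP k : (k < nt)%N -> schatten p (active b A L U k) <= rho * schatten p A.
  exact: schatten_active_le.
split=> [L_unitary|U_unitary]; first exact: schatten_LU_le.
(* From here on, [A^* = U^* L^*] plays the role of [A = L U]: its lower factor has the unitary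
   diagonal blocks. *)
have kappa_ctr : kappa p (ctr A) = kappa p A.
  by rewrite /kappa invmx_ctr !schatten_ctr.
have ctrA_unit : ctr A \in unitmx by rewrite /ctr unitmx_tr map_unitmx.
have ctrALU : ctr A = ctr U *m ctr L by rewrite [in LHS]ALU ctrM.
have low_ctr : block_lower nt b (ctr U).
  by move=> k i j knt ij; rewrite ctrE (upU k _ _ knt ij) conjC0.
have up_ctr : block_upper nt b (ctr L).
  by move=> k i j knt ij; rewrite ctrE (lowL k _ _ knt ij) conjC0.
have rho_ctr k : (k < nt)%N ->
    schatten p (active b (ctr A) (ctr U) (ctr L) k) <= rho * schatten p (ctr A).
  rewrite active_ctr (schatten_ctr p1 A) (schatten_ctr p1 (active _ _ _ _ _)).
  exact: rhoP.
have unitary_ctr k : (k < nt)%N ->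
    unitary (subm (ctr U) (nth 0%N b k) (nth 0%N b k)
      (nth 0%N b k.+1 - nth 0%N b k) (nth 0%N b k.+1 - nth 0%N b k)).
  (* [unitary] asks for [U^* U = 1]; for the adjoint block this becomes [U U^* = 1], equivalent for
     square matrices. *)
  by move=> knt; rewrite subm_ctr /unitary ctrK; apply/mulmx1C/U_unitary.
have := schatten_LU_le blk ctrA_unit p1 ctrALU low_ctr up_ctr rho0
  rho_ctr unitary_ctr.
rewrite /= kappa_ctr (schatten_ctr p1 A) (schatten_ctr p1 U) (schatten_ctr p1 L).
case=> U_le L_le LU_le; split; [exact: U_le | exact: L_le |].
by rewrite [leLHS]mulrC; exact: LU_le.
Qed.
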